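(* Let $(\alpha,\beta)\in(0,1/2)^2$, and let $(\Delta^{IP}_{\alpha,\varepsilon})_{\varepsilon}$ and $(\Delta^{DP}_{\alpha,\varepsilon})_{\varepsilon}$ be the inverse and direct testing procedures, with thresholds $t_{\alpha,\varepsilon}=C_{\alpha,1}\varepsilon^2\sqrt{\sum_{k=1}^{D_\varepsilon}b_k^{-4}}$ and $s_{\alpha,\varepsilon}=C_{\alpha,2}\varepsilon^2\sqrt{D_\varepsilon}$ respectively. Then, for any choice of detection rates $r=(r_\varepsilon)_{\varepsilon}$ and $\mu=(\mu_\varepsilon)_{\varepsilon}$: 1. There exist two positive constants $C_{\min}(\alpha,\beta)$ and $C_{\max}(\alpha,\beta)$, depending on $C_{\alpha,1}$ and $\beta$, such that $$\mathcal{F}_{r,D}(C_{\max}(\alpha,\beta))\subset MS(\Delta^{IP}_{\alpha},r)\subset \mathcal{F}_{r,D}(C_{\min}(\alpha,\beta)).$$ 2. There exist two positive constants $C'_{\min}(\alpha,\beta)$ and $C'_{\max}(\alpha,\beta)$, depending on $C_{\alpha,2}$ and $\beta$, such that $$\mathcal{G}_{\mu,D}(C'_{\max}(\alpha,\beta))\subset MS(\Delta^{DP}_{\alpha},\mu)\subset \mathcal{G}_{\mu,D}(C'_{\min}(\alpha,\beta)).$$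
   Context: Model: $\mathbb{N}^*=\{1,2,\dots\}$, $\varepsilon\in(0,1)$ is a noise level, and one observes $y_k=b_k\theta_k+\varepsilon\xi_k$, $k\in\mathbb{N}^*$, where $\theta=(\theta_k)_{k}\in l_2(\mathbb{N}^* )$ is unknown, $b=(b_k)_k$ is a known sequence of positive real numbers, and $(\xi_k)_k$ are i.i.d. standard Gaussian. $\mathbb{P}_\theta$ is the law of $y=(y_k)_k$, and $\|\theta\|^2=\sum_k\theta_k^2$. $D=(D_\varepsilon)_\varepsilon$ is a family of non-negative integers, monotone in the sense that $D_\varepsilon$ does not decrease as $\varepsilon$ decreases to $0$. Detection rates $r=(r_\varepsilon)_\varepsilon$, $\mu=(\mu_\varepsilon)_\varepsilon$ are families of non-negative reals that do not increase as $\varepsilon$ decreases to $0$. Tests (value $1$ means rejecting $H_0:\theta=0$): $\Delta^{IP}_{\alpha,\varepsilon}=\mathbf{1}_{\{T_{D_\varepsilon}>t_{\alpha,\varepsilon}\}}$ with $T_{D_\varepsilon}=\sum_{k=1}^{D_\varepsilon}b_k^{-2}(y_k^2-\varepsilon^2)$, and $\Delta^{DP}_{\alpha,\varepsilon}=\mathbf{1}_{\{S_{D_\varepsilon}>s_{\alpha,\varepsilon}\}}$ with $S_{D_\varepsilon}=\sum_{k=1}^{D_\varepsilon}(y_k^2-\varepsilon^2)$. The constants $C_{\alpha,1},C_{\alpha,2}>0$ in the thresholds are fixed so that both tests have Type-I error at most $\alpha$ for all $\varepsilon\in(0,1)$: $\mathbb{P}_{0}(\Delta^{IP}_{\alpha,\varepsilon}=1)\le\alpha$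 and $\mathbb{P}_{0}(\Delta^{DP}_{\alpha,\varepsilon}=1)\le\alpha$. Maxiset of a family of tests $\Delta_\alpha=(\Delta_{\alpha,\varepsilon})_\varepsilon$ for the rate $r$ (with $\beta$ fixed): $$MS(\Delta_\alpha,r)=\{\theta\in l_2(\mathbb{N}^* ):\ \forall\varepsilon\in(0,1),\ [\|\theta\|^2\ge r_\varepsilon^2\Rightarrow \mathbb{P}_\theta(\Delta_{\alpha,\varepsilon}=0)\le\beta]\}.$$ Sequence spaces, for $C>0$: $$\mathcal{F}_{r,D}(C)=\Big\{\theta\in l_2(\mathbb{N}^* ):\ \forall\varepsilon\in(0,1),\ \Big[\|\theta\|^2\ge r_\varepsilon^2\Rightarrow\sum_{k=1}^{D_\varepsilon}\theta_k^2>C\varepsilon^2\sqrt{\sum_{k=1}^{D_\varepsilon}b_k^{-4}}\Big]\Big\},$$ $$\mathcal{G}_{r,D}(C)=\Big\{\theta\in l_2(\mathbb{N}^* ):\ \forall\varepsilon\in(0,1),\ \Big[\|\theta\|^2\ge r_\varepsilon^2\Rightarrow\sum_{k=1}^{D_\varepsilon}b_k^2\theta_k^2>C\varepsilon^2\sqrt{D_\varepsilon}\Big]\Big\}.$$ *)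

(* Defs.v *)
From HB Require Import structures.
From mathcomp Require Import all_boot all_order all_algebra.
From mathcomp Require Import all_classical all_reals all_analysis.

Set Implicit Arguments.
Unset Strict Implicit.
Unset Printing Implicit Defensive.

Import Order.TTheory GRing.Theory Num.Theory.
Import numFieldNormedType.Exports.

Local Open Scope classical_set_scope.
Local Open Scope ring_scope.

(* Sequences indexed by {1, 2, ...} are functions on nat with the index shifted
   by one: [u k] is the (k+1)-th term, and [\sum_(k < n)] is the sum of the
   first n terms.  Families indexed by the noise level are functions on R, of
   which only the values on the open interval (0, 1) matter. *)

Section SequenceSpaces.
Context {R : realType}.
Implicit Types (theta b : nat -> R) (r : R -> R) (D : R -> nat).

Definition l2 : set (nat -> R) :=
  [set theta : nat -> R | cvgn (series (fun k => theta k ^+ 2))].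

Definition sqnorm theta : R := limn (series (fun k => theta k ^+ 2)).

Definition detection_rate r : Prop :=
  (forall eps, 0 < eps < 1 -> 0 <= r eps) /\
  (forall eps eps', 0 < eps -> eps <= eps' -> eps' < 1 -> r eps <= r eps').

Definition monotone_dimension D : Prop :=
  forall eps eps', 0 < eps -> eps <= eps' -> eps' < 1 -> (D eps' <= D eps)%N.

Definition Fspace b r D (C : R) : set (nat -> R) :=
  [set theta : nat -> R | l2 theta /\ forall eps, 0 < eps < 1 ->
     r eps ^+ 2 <= sqnorm theta ->
     C * eps ^+ 2 * Num.sqrt (\sum_(k < D eps) b k ^- 4)
       < \sum_(k < D eps) theta k ^+ 2].

Definition Gspace b r D (C : R) : set (nat -> R) :=
  [set theta : nat -> R | l2 theta /\ forall eps, 0 < eps < 1 ->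
     r eps ^+ 2 <= sqnorm theta ->
     C * eps ^+ 2 * Num.sqrt (D eps)%:R
       < \sum_(k < D eps) b k ^+ 2 * theta k ^+ 2].

End SequenceSpaces.

Section Model.
Context {R : realType} {d : measure_display} {T : measurableType d}.
Variable P : probability T R.

Definition mutually_independent (X : nat -> {RV P >-> R}) : Prop :=
  forall (J : seq nat) (A : nat -> set R), uniq J ->
    (forall k, measurable (A k)) ->
    P (\bigcap_(k in [set` J]) (X k @^-1` A k))
      = (\prod_(k <- J) P (X k @^-1` A k))%E.

Definition iid_std_gaussian (xi : nat -> {RV P >-> R}) : Prop :=
  (forall k (A : set R), measurable A ->
     distribution P (xi k) A = normal_prob 0 1 A) /\
  mutually_independent xi.

Variables (xi : nat -> {RV P >-> R}) (b : nat -> R).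

Definition observation (theta : nat -> R) (eps : R) (w : T) : nat -> R :=
  fun k => b k * theta k + eps * xi k w.

(* The law P_theta of y at noise level eps: the image of P under y. *)
Definition law (theta : nat -> R) (eps : R) (A : set (nat -> R)) : \bar R :=
  P (observation theta eps @^-1` A).

End Model.

Section Tests.
Context {R : realType}.

(* [Delta eps y = true] means that H_0 : theta = 0 is rejected. *)
Definition test_family : Type := R -> (nat -> R) -> bool.

Implicit Types (b : nat -> R) (D : R -> nat) (C eps : R) (y : nat -> R).

Definition T_stat b D eps y : R :=
  \sum_(k < D eps) b k ^- 2 * (y k ^+ 2 - eps ^+ 2).

Definition S_stat D eps y : R :=
  \sum_(k < D eps) (y k ^+ 2 - eps ^+ 2).

Definition t_threshold b D C eps : R :=
  C * eps ^+ 2 * Num.sqrt (\sum_(k < D eps) b k ^- 4).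

Definition s_threshold D C eps : R :=
  C * eps ^+ 2 * Num.sqrt (D eps)%:R.

Definition DeltaIP b D C : test_family :=
  fun eps y => t_threshold b D C eps < T_stat b D eps y.

Definition DeltaDP D C : test_family :=
  fun eps y => s_threshold D C eps < S_stat D eps y.

Context {d : measure_display} {T : measurableType d}.
Variables (P : probability T R) (xi : nat -> {RV P >-> R}) (b : nat -> R).

Definition level (alpha : R) (Delta : test_family) : Prop :=
  forall eps, 0 < eps < 1 ->
    (law xi b (fun=> 0%R) eps [set y | Delta eps y = true] <= alpha%:E)%E.

Definition maxiset (beta : R) (Delta : test_family) (r : R -> R) :
    set (nat -> R) :=
  [set theta : nat -> R | l2 theta /\ forall eps, 0 < eps < 1 ->
     r eps ^+ 2 <= sqnorm theta ->
     (law xi b theta eps [set y | Delta eps y = false] <= beta%:E)%E].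

End Tests.

Arguments test_family : clear implicits.

(* Main.v *)
Require Import Defs.
From HB Require Import structures.
From mathcomp Require Import all_boot all_order all_algebra.
From mathcomp Require Import all_classical all_reals all_analysis.
From mathcomp Require Import ring lra.
From mathcomp Require Import measurable_realfun.

Import Order.TTheory GRing.Theory Num.Theory.
Import numFieldNormedType.Exports.
Import HBNNSimple.

Set Implicit Arguments.
Unset Strict Implicit.
Unset Printing Implicit Defensive.

Local Open Scope classical_set_scope.
Local Open Scope ring_scope.

(** Both tests are instances of one weighted test, which rejects when
    [\sum_(k < D) w_k (y_k^2 - eps^2)] exceeds [C eps^2 W], where
    [W = sqrt (\sum_(k < D) w_k^2)]; the weights are [b_k^-2] for the inverse test
    and [1] for the direct one. After division by [eps^2], with
    [mu_k = b_k theta_k / eps] and [m = \sum_k w_k mu_k^2], the test accepts when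
    [S = \sum_k w_k ((mu_k + xi_k)^2 - 1) <= C W], and both inclusions compare the
    signal strength [m] with [W].

    If [m] is a large multiple of [W], a Chernoff bound for the lower tail of a
    noncentral weighted chi-square makes the miss probability at most [beta]
    ([small_miss_probability]).

    Conversely, write [S = Q + L], where [Q] is the statistic under the null
    hypothesis and [L = m + 2 \sum_k w_k mu_k xi_k] is Gaussian. If [m] is a small
    multiple of [W], then [L >= delta W] has small probability, so outside a small
    event the test can reject only if [Q > (C - delta) W]. The level controls
    [Q > C W] by [alpha < 1/2]. What remains is the probability that [Q] falls in
    an interval of length [delta W], and this has to be small uniformly in the
    weights, since the constants must not depend on them. With the two small events
    of probability at most [(1/2 - beta) / 2] each, the miss probability is at
    least [1 - alpha - (1/2 - beta) > beta] ([signal_of_small_miss]).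

    The uniform bound is [weighted_chi2_anticoncentration]. Comparing a chi-square
    sum [Z = \sum_k w_k xi_k^2] with an independent copy [Z'] on
    an interval [I] of length [delta] gives
    [P (Z \in I)^2 <= P (|Z - Z'| <= delta)
       <= sqrt e * E (exp (- (Z - Z')^2 / (2 delta^2)))].
    A rotation of the plane by 45 degrees turns [xi_k^2 - xi'_k^2] into [2 u_k v_k]
    ([gaussian_rotation]), and integrating over [u_k] turns a Gaussian kernel of
    variance [tau] into a multiple of the one of variance
    [tau + 4 w_k^2 v_k^2]. So each coordinate spreads the kernel, and an induction
    on the number of coordinates ([overlap_decay_add_square]) gives a bound that
    involves the weights through [W] only. All integrands are nonnegative, so
    that integrals are exchanged by Tonelli's theorem without integrability
    conditions. *)

(** * Integration against the Gaussian law *)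

Lemma integral_density d (T : measurableType d) (R : realType)
    (mu nu : {measure set T -> \bar R}) (g : T -> R) :
  measurable_fun setT g -> (forall x, 0 <= g x) ->
  (forall A, measurable A -> nu A = \int[mu]_(x in A) (g x)%:E)%E ->
  forall f : T -> \bar R, measurable_fun setT f -> (forall x, 0 <= f x)%E ->
  (\int[nu]_x f x = \int[mu]_x (f x * (g x)%:E))%E.
Proof.
move=> mg g0 nuE f mf f0.
have mgE : measurable_fun setT (EFin \o g) by exact/measurable_EFinP.
(* The formula passes from indicators to simple functions to monotone limits. *)
have ind E : measurable E ->
    (\int[nu]_x (\1_E x)%:E = \int[mu]_x ((\1_E x)%:E * (g x)%:E))%E.
  move=> mE; rewrite integral_indic// setIT nuE// integral_mkcond.
  apply: eq_integral => x _; rewrite patchE indicE.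
  by case: ifP => _; rewrite ?mul1e ?mul0e.
have sf (h : {nnsfun T >-> R}) :
    (\int[nu]_x (h x)%:E = \int[mu]_x ((h x)%:E * (g x)%:E))%E.
  under [LHS]eq_integral do rewrite fimfunE -fsumEFin//.
  rewrite [LHS]ge0_integral_fsum//; last 2 first.
    - by move=> r; exact/measurable_EFinP/measurableT_comp.
    - by move=> n x _; rewrite EFinM nnfun_muleindic_ge0.
  under [RHS]eq_integral.
    move=> x xD; rewrite fimfunE -fsumEFin// ge0_mule_fsuml; last first.
      by move=> r; rewrite EFinM nnfun_muleindic_ge0.
    over.
  rewrite [RHS]ge0_integral_fsum//; last 2 first.
    - move=> r; apply: emeasurable_funM => //.
      exact/measurable_EFinP/measurableT_comp.
    - move=> n x _; rewrite mule_ge0 ?lee_fin//.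
      by have := nnfun_muleindic_ge0 h n x; rewrite -EFinM lee_fin.
  apply: eq_fsbigr => r; rewrite inE => -[z _ <-].
  under eq_integral do rewrite EFinM.
  under [RHS]eq_integral do rewrite EFinM -muleA.
  rewrite !ge0_integralZl ?ind ?lee_fin//.
  - by apply: emeasurable_funM => //; exact/measurable_EFinP.
  - by move=> x _; rewrite mule_ge0 ?lee_fin.
  - exact/measurable_EFinP.
pose f_ := nnsfun_approx measurableT mf.
transitivity (limn (fun n => \int[nu]_x (f_ n x)%:E))%E.
  rewrite -monotone_convergence//=.
  - by apply: eq_integral => x _; apply/esym/cvg_lim => //=; exact: cvg_nnsfun_approx.
  - by move=> n; exact/measurable_EFinP/measurable_funTS.
  - by move=> n ? _; rewrite lee_fin.
  - by move=> ? _ ? ? mn; rewrite lee_fin; exact/lefP/nd_nnsfun_approx.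
transitivity (limn (fun n => \int[mu]_x ((f_ n x)%:E * (g x)%:E)))%E.
  by apply: congr_lim; apply/funext => n; exact: sf.
rewrite -monotone_convergence//=.
- apply: eq_integral => x _; apply/cvg_lim => //=.
  by apply: cvgeZr => //; exact: cvg_nnsfun_approx.
- move=> n; apply: emeasurable_funM => //.
  exact/measurable_EFinP/measurable_funTS.
- by move=> n x _; rewrite mule_ge0// lee_fin.
- move=> x _ m n mn; rewrite lee_wpmul2r ?lee_fin//.
  exact/lefP/nd_nnsfun_approx.
Qed.

Section StandardNormal.
Variable R : realType.
Let RM := Real_sort__canonical__measurable_structure_Measurable R.

Let measurable_id_realType :
  @measurable_fun _ _ (measurableTypeR R) RM setT idfun.
Proof. by move=> mT Y mY; rewrite setTI; exact: mY. Qed.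

Let id_realType : {mfun measurableTypeR R >-> RM} :=
  @mfun_Sub _ _ (measurableTypeR R) RM idfun (mem_set measurable_id_realType).

(** The type [R] and [measurableTypeR R] carry the same measurable sets under
    different displays; pushing forward along the identity gives a probability on
    [R] itself, which product measures with laws of real random variables need. *)
Definition std_normal : probability R R :=
  distribution (normal_prob (0 : R) 1) id_realType.

End StandardNormal.
Arguments std_normal : simpl never.

Lemma integral_std_normal (R : realType) (f : R -> \bar R) :
  measurable_fun setT f -> (forall x, 0 <= f x)%E ->
  (\int[std_normal R]_x f x
   = \int[lebesgue_measure]_x (f x * (normal_pdf 0 1 x)%:E))%E.
Proof.
move=> mf f0; rewrite ge0_integral_distribution//.
apply: (@integral_density _ _ R lebesgue_measure (normal_prob 0 1)) => //.
- exact: measurable_normal_pdf.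
- by move=> x; exact: normal_pdf_ge0.
Qed.

Lemma normal_peak_scale (R : realType) (s : R) : 0 < s ->
  normal_peak s = s^-1 * normal_peak 1.
Proof.
move=> s0; rewrite /normal_peak expr1n mul1r -mulrnAr.
by rewrite sqrtrM ?sqr_ge0// sqrtr_sqr gtr0_norm// invfM.
Qed.

(** Completing the square: the integrand times the standard density is a multiple
    of the normal density of mean [b / (1 + 2 a)] and variance [(1 + 2 a)^-1].
    Every exponential moment below is an instance of this formula. *)
Lemma integral_gaussian_exp (R : realType) (a b : R) : 0 <= a ->
  (\int[std_normal R]_x (expR (- a * x ^+ 2 + b * x))%:E
   = ((Num.sqrt (1 + 2 * a))^-1 * expR (b ^+ 2 / (2 * (1 + 2 * a))))%:E)%E.
Proof.
move=> a0; set c := 1 + 2 * a.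
have c0 : 0 < c by rewrite /c; lra.
have sc0 : 0 < Num.sqrt c by rewrite sqrtr_gt0.
set s := (Num.sqrt c)^-1.
have s0 : 0 < s by rewrite /s invr_gt0.
have s2 : s ^+ 2 = c^-1 by rewrite /s exprVn sqr_sqrtr// ltW.
rewrite integral_std_normal; last 2 first.
- apply/measurable_EFinP; apply: measurableT_comp => //.
  by apply: measurable_funD; apply: measurable_funM => //; exact: measurable_funX.
- by move=> x; rewrite lee_fin expR_ge0.
transitivity (\int[lebesgue_measure]_x
    ((s * expR (b ^+ 2 / (2 * c)))%:E * (normal_pdf (b / c) s x)%:E))%E.
  apply: eq_integral => x _; rewrite -!EFinM; congr (_ %:E).
  rewrite normal_pdfE ?oner_eq0//.
  rewrite normal_pdfE ?gt_eqF// (normal_peak_scale s0).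
  rewrite /normal_fun mulrCA [RHS](_ : _ = s * s^-1 * (normal_peak 1 *
    (expR (b ^+ 2 / (2 * c)) * expR (- (x - b / c) ^+ 2 / (s ^+ 2 *+ 2)))));
    last by ring.
  rewrite divff ?gt_eqF// mul1r; congr (_ * _).
  rewrite -!expRD; congr expR.
  rewrite s2 /c; field.
  by rewrite -/c !gt_eqF//=.
rewrite ge0_integralZl//=.
- by rewrite integral_normal_pdf mule1.
- by apply/measurable_EFinP; exact: measurable_normal_pdf.
- by move=> x _; rewrite lee_fin normal_pdf_ge0.
- by rewrite lee_fin mulr_ge0 ?expR_ge0// ltW.
Qed.

Lemma integral_affine_change (R : realType) (al be : R) (f : R -> R) :
  0 < al -> continuous f -> (forall x, 0 <= f x) ->
  (\int[lebesgue_measure]_x (f x)%:E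
   = \int[lebesgue_measure]_x (f (al * x + be) * al)%:E)%E.
Proof.
move=> al0 cf f0; pose F (x : R^o) : R := al * x + be.
have dF x : derivable F x 1.
  by apply: derivableD => //; apply: derivableM.
have F'E : F^`()%classic = cst al.
  apply/funext => x; rewrite /F derive1E deriveD// ?deriveM//=.
    by rewrite !derive_cst derive_id scaler0 !addr0 scaler1.
have FE : F = (fun x => al * (x + be / al)).
  by apply/funext => x; rewrite /F mulrDr mulrCA divff ?mulr1// gt_eqF.
rewrite (@increasing_ge0_integration_by_substitutionT R F f).
- by apply: eq_integral => x _; rewrite F'E !fctE.
- by move=> x y xy; rewrite /F ltrD2r ltr_pM2l.
- by rewrite F'E => ?; exact: cvg_cst.
- by rewrite F'E; exact: is_cvg_cst.
- by rewrite F'E; exact: is_cvg_cst.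
- exact: dF.
- by rewrite FE; apply: gt0_cvgMrNy => //; exact: cvg_addrr_Ny.
- by rewrite FE; apply: gt0_cvgMry => //; exact: cvg_addrr.
- exact: cf.
- exact: f0.
Qed.

(** The substitution [x = (u + v) / sqrt 2], [y = (v - u) / sqrt 2] preserves the
    Gaussian law of the plane and turns [x^2 - y^2] into [2 u v]. It is carried out
    as two one-dimensional affine changes of variable between applications of
    Tonelli's theorem. *)
Lemma gaussian_rotation (R : realType) (f : R -> R) :
  continuous f -> (forall x, 0 <= f x) ->
  (\int[std_normal R]_x \int[std_normal R]_y (f (x ^+ 2 - y ^+ 2))%:E
   = \int[std_normal R]_x \int[std_normal R]_y (f (2 * x * y))%:E)%E.
Proof.
move=> cf f0; have mf : measurable_fun setT f by exact: continuous_measurable_fun.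
pose phi : R -> R := normal_pdf 0 1.
have phi0 x : 0 <= phi x by exact: normal_pdf_ge0.
have mphi : measurable_fun setT phi by exact: measurable_normal_pdf.
have cphi : continuous phi by apply: continuous_normal_pdf; rewrite oner_eq0.
pose s : R := Num.sqrt 2.
have s0 : 0 < s by rewrite sqrtr_gt0.
have s2 : s ^+ 2 = 2 by rewrite sqr_sqrtr.
have unfold (h : R * R -> R) : measurable_fun setT h -> (forall p, 0 <= h p) ->
  (\int[std_normal R]_x \int[std_normal R]_y (h (x, y))%:E
   = \int[lebesgue_measure]_x \int[lebesgue_measure]_y
       (h (x, y) * phi x * phi y)%:E)%E.
  move=> mh h0.
  have mhE : measurable_fun setT (EFin \o h) by exact/measurable_EFinP.
  rewrite integral_std_normal; last 2 first.
  - apply: (@measurable_fun_fubini_tonelli_F _ _ _ _ _ (std_normal R) (EFin \o h)) => //.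
  - by move=> x; apply: integral_ge0 => y _; rewrite lee_fin.
  apply: eq_integral => x _.
  have mhx : measurable_fun setT (fun y => h (x, y)).
    exact: measurable_fun_pair2.
  rewrite integral_std_normal; last 2 first.
  - exact/measurable_EFinP.
  - by move=> y; rewrite lee_fin.
  rewrite -ge0_integralZr ?lee_fin//.
  - by apply: eq_integral => y _; rewrite -!EFinM mulrAC.
  - apply: emeasurable_funM; exact/measurable_EFinP.
  - by move=> y _; rewrite mule_ge0 ?lee_fin//; exact: phi0.
pose q (p : R * R) := f (p.1 ^+ 2 - p.2 ^+ 2).
have mq : measurable_fun setT q.
  apply: measurableT_comp => //; apply: measurable_funB; exact: measurable_funX.
pose k (p : R * R) := f (2 * p.1 * p.2).
have mk : measurable_fun setT k.
  apply: measurableT_comp => //; apply: measurable_funM => //.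
  exact: measurable_funM.
pose G (p : R * R) := q p * phi p.1 * phi p.2.
have mG : measurable_fun setT G.
  apply: measurable_funM; last exact: measurableT_comp mphi measurable_snd.
  by apply: measurable_funM => //; exact: measurableT_comp mphi measurable_fst.
have G0 p : 0 <= G p by rewrite /G !mulr_ge0// f0.
pose H (p : R * R) := G (s * p.2 + p.1, p.1) * s.
have mH : measurable_fun setT H.
  apply: measurable_funM => //; apply: (measurableT_comp mG).
  apply: measurable_fun_pair => //; apply: measurable_funD => //.
  exact: measurable_funM.
rewrite (unfold k)//; last by move=> p; exact: f0.
etransitivity; first exact: (unfold q mq (fun p => f0 _)).
etransitivity.
  apply: (fubini_tonelli (m1 := lebesgue_measure) (m2 := lebesgue_measure) (EFin \o G)).
    exact/measurable_EFinP.
  by move=> p; rewrite /= lee_fin.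
transitivity (\int[lebesgue_measure]_y \int[lebesgue_measure]_u (H (y, u))%:E)%E.
  apply: eq_integral => y _.
  rewrite (@integral_affine_change R s y (fun x => G (x, y)))//.
  move=> x; rewrite /G/=; apply: cvgM; last exact: cvg_cst.
  apply: cvgM; last exact: cphi.
  apply: (@continuous_comp _ _ _ (fun x : R => x ^+ 2 - y ^+ 2) f); last exact: cf.
  by apply: cvgB; [exact: exprn_continuous|exact: cvg_cst].
etransitivity.
  apply: (fubini_tonelli (m1 := lebesgue_measure) (m2 := lebesgue_measure) (EFin \o H)).
    exact/measurable_EFinP.
  by move=> p; rewrite /= lee_fin mulr_ge0// ltW.
apply: eq_integral => u _.
rewrite (@integral_affine_change R s^-1 (- (u / s)) (fun y => H (y, u))); last 3 first.
- by rewrite invr_gt0.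
- move=> y; rewrite /H /G/=; apply: cvgM; last exact: cvg_cst.
  have cl : {for y, continuous (fun y : R => s * u + y)}.
    by apply: cvgD; [exact: cvg_cst|exact: cvg_id].
  apply: cvgM; last exact: cphi.
  apply: cvgM; last first.
    apply: (@continuous_comp _ _ _ (fun y : R => s * u + y) phi); first exact: cl.
    exact: cphi.
  apply: (@continuous_comp _ _ _ (fun y : R => (s * u + y) ^+ 2 - y ^+ 2) f);
    last exact: cf.
  apply: cvgB; last exact: exprn_continuous.
  apply: (@continuous_comp _ _ _ (fun y : R => s * u + y) (fun x => x ^+ 2)).
    exact: cl.
  exact: exprn_continuous.
- by move=> y; rewrite mulr_ge0// ltW.
apply: eq_integral => v _; congr (_ %:E); rewrite /H /G /q /k /phi /=.
rewrite !normal_pdfE ?oner_eq0//.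
have -> : s * u + (s^-1 * v - u / s) = (s ^+ 2 * u + v - u) / s.
  by field; rewrite gt_eqF.
have -> : s^-1 * v - u / s = (v - u) / s by field; rewrite gt_eqF.
rewrite !expr_div_n s2 -mulrA divff ?gt_eqF// mulr1.
rewrite (_ : _ / 2 - _ / 2 = 2 * u * v); last by field.
rewrite [LHS](_ : _ = f (2 * u * v) * (normal_peak 1 ^+ 2 *
  (normal_fun 0 1 ((s ^+ 2 * u + v - u) / s) * normal_fun 0 1 ((v - u) / s))));
  last by rewrite s2; ring.
rewrite [RHS](_ : _ = f (2 * u * v) * (normal_peak 1 ^+ 2 *
  (normal_fun 0 1 u * normal_fun 0 1 v))); last by ring.
rewrite /normal_fun -!expRD !subr0 !expr_div_n s2.
by congr (_ * (_ * expR _)); field.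
Qed.

(** * Partial sums of functions of independent noise variables *)

Section PartialSums.
Context {R : realType} {d : measure_display} {T : measurableType d}.
Variables (P : probability T R) (xi : nat -> {RV P >-> R}).

Let tail_event (J : seq nat) (A : nat -> set R) : set T :=
  \bigcap_(k in [set` J]) (xi k @^-1` A k).

(** Keeping a whole family of later events on the right-hand side is what makes
    this property pass from [n] to [n.+1]; pairwise independence of [S] from each
    [xi k] would not suffice. *)
Definition independent_of_tail (n : nat) (S : T -> R) : Prop :=
  forall (J : seq nat) (A : nat -> set R) (B : set R),
    uniq J -> all (leq n) J -> (forall k, measurable (A k)) -> measurable B ->
    P (S @^-1` B `&` tail_event J A)
      = (P (S @^-1` B) * \prod_(k <- J) P (xi k @^-1` A k))%E.

Let measurable_tail_event J A : (forall k, measurable (A k)) ->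
  measurable (tail_event J A).
Proof.
move=> mA; rewrite /tail_event bigcap_seq; apply: bigsetI_measurable => k _.
by rewrite -[X in measurable X]setTI; exact: measurable_funP.
Qed.

Hypothesis xi_gauss : iid_std_gaussian xi.

(** Both sides are finite measures in [X] that agree on rectangles: a rectangle
    adds [xi n] to the family of tail variables. The tail event is carried along for
    the induction; with an empty family this says that the law of [(S, xi n)] is a
    product. *)
Lemma joint_law_next (n : nat) (S : {RV P >-> R}) : independent_of_tail n S ->
  forall (J : seq nat) (A : nat -> set R) (X : set (R * R)),
    uniq J -> all (ltn n) J -> (forall k, measurable (A k)) -> measurable X ->
  P ((fun w => (S w, xi n w)) @^-1` X `&` tail_event J A)
    = ((distribution P S \x std_normal R) X
       * \prod_(k <- J) P (xi k @^-1` A k))%E.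
Proof.
move=> indS J A X uJ nJ mA mX.
set c := (\prod_(k <- J) _)%E.
have mE := @measurable_tail_event J A mA.
have c0 : (0 <= c)%E by rewrite /c; apply: prode_ge0.
have cfin : c \is a fin_num.
  by rewrite /c; apply: prode_fin_num => k _; apply: fin_num_measure;
    rewrite -[X in measurable X]setTI; exact: measurable_funP.
have cN0 : 0 <= fine c by rewrite fine_ge0.
have mphi : measurable_fun setT (fun w => (S w, xi n w)).
  by apply: measurable_fun_pair.
pose phi w := (S w, xi n w).
pose push : {measure set (R * R) -> \bar R} :=
  pushforward (mrestr P mE) phi.
pose m1 := push mphi.
pose m2 : {measure set (R * R) -> \bar R} :=
  mscale (NngNum cN0) (distribution P S \x std_normal R)%E.
pose G : set (set (R * R)) :=
  [set C | exists A, measurable A /\ exists B, measurable B /\ C = A `*` B].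
have rect B1 B2 : measurable B1 -> measurable B2 ->
    P ((fun w => (S w, xi n w)) @^-1` (B1 `*` B2) `&` tail_event J A)
    = (P (S @^-1` B1) * P (xi n @^-1` B2) * c)%E.
  move=> mB1 mB2.
  pose A' k := if k == n then B2 else A k.
  have nJ' : n \notin J by apply/negP => /(allP nJ); rewrite /= ltnn.
  have -> : (fun w => (S w, xi n w)) @^-1` (B1 `*` B2) `&` tail_event J A
      = S @^-1` B1 `&` tail_event (n :: J) A'.
    apply/seteqP; split => w /=.
      move=> [[SB xB] tw]; split => // k /=; rewrite inE => /orP[/eqP ->|kJ].
        by rewrite /A' eqxx.
      rewrite /A'; case: eqP => [kn|_]; last exact: tw.
      by move: nJ'; rewrite -kn kJ.
    move=> [SB tw]; split; last move=> k kJ.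
      split => //; have := tw n; rewrite /A' /= eqxx; apply.
      by rewrite inE eqxx.
    have := tw k; rewrite /A' /=; case: eqP => [kn|_]; last first.
      by apply; rewrite inE kJ orbT.
    by move: nJ'; rewrite -kn kJ.
  rewrite indS//=.
  - rewrite big_cons {1}/A' eqxx muleA; congr (_ * _)%E.
    rewrite /c big_seq [RHS]big_seq; apply: eq_bigr => k kJ.
    by rewrite /A'; case: eqP => // kn; move: nJ'; rewrite -kn kJ.
  - by rewrite nJ'.
  - by rewrite leqnn/=; apply: sub_all nJ => k /ltnW.
  - by move=> k; rewrite /A'; case: ifP.
have m12 : forall Y : set (R * R), measurable Y -> m1 Y = m2 Y.
  apply: (measure_unique G (fun=> setT)).
  - rewrite measurable_prod_measurableType //; congr (<<s _ >>).
    rewrite predeqE; split => [[B mB [C mC <-]]|[B [mB [C [mC ->]]]]].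
      by exists B; split => //; exists C.
    by exists B => //; exists C.
  - move=> _ _ [X1 [mX1 [X2 [mX2 ->]]]] [Y1 [mY1 [Y2 [mY2 ->]]]].
    rewrite -setXI; exists (X1 `&` Y1); split; first exact: measurableI.
    by exists (X2 `&` Y2); split => //; exact: measurableI.
  - move=> _; exists setT; split => //; exists setT; split => //.
    by rewrite setXTT.
  - by apply/seteqP; split => // p _; exists 0%N.
  - move=> _ [B1 [mB1 [B2 [mB2 ->]]]].
    rewrite /m1 /m2 /push /= /pushforward /mrestr /mscale /= rect//.
    rewrite product_measure1E//.
    rewrite [X in (_ * (_ * X))%E](_ : _ = P (xi n @^-1` B2)); last first.
      exact/esym/(xi_gauss.1 n).
    by rewrite fineK// muleC.
  - move=> _; rewrite /m1 /push /= /pushforward /mrestr.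
    apply: le_lt_trans (probability_le1 _ _) (ltry _).
    by apply: measurableI => //; rewrite preimage_setT.
have := m12 X mX; rewrite /m1 /m2 /push /= /pushforward /mrestr /mscale /= fineK//.
by rewrite muleC.
Qed.

Lemma independent_of_tail0 (c : R) : independent_of_tail 0 (fun=> c).
Proof.
move=> J A B uJ _ mA mB; rewrite preimage_cst; case: ifPn => _.
  by rewrite setTI probability_setT mul1e xi_gauss.2.
by rewrite set0I measure0 mul0e.
Qed.

Lemma independent_of_tailS (n : nat) (S : {RV P >-> R}) (h : R * R -> R) :
  independent_of_tail n S -> measurable_fun setT h ->
  independent_of_tail n.+1 (fun w => h (S w, xi n w)).
Proof.
move=> indS mh J A B uJ nJ mA mB.
have mX : measurable (h @^-1` B) by rewrite -[X in measurable X]setTI; exact: mh.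
have := joint_law_next indS uJ nJ mA mX.
have := @joint_law_next _ _ indS [::] A _ isT isT mA mX.
rewrite big_nil mule1 /tail_event/= set_nil bigcap_set0 setIT => <- <-.
by [].
Qed.

(** The form in which independence is used: the next noise variable can be
    integrated separately, inside the law of [S]. *)
Lemma integral_next (n : nat) (S : {RV P >-> R}) (f : R * R -> \bar R) :
  independent_of_tail n S -> measurable_fun setT f -> (forall p, 0 <= f p)%E ->
  (\int[P]_w f (S w, xi n w)
   = \int[distribution P S]_s \int[std_normal R]_x f (s, x))%E.
Proof.
move=> indS mf f0.
have mphi : measurable_fun setT (fun w => (S w, xi n w)).
  by apply: measurable_fun_pair.
pose phi : {mfun T >-> (R * R)%type} := mfun_Sub (mem_set mphi).
rewrite -(fubini_tonelli1 (m1 := distribution P S) (m2 := std_normal R))//.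
transitivity (\int[distribution P phi]_p f p)%E.
  by rewrite ge0_integral_distribution.
apply: eq_measure_integral => X mX _.
have := @joint_law_next _ _ indS [::] (fun=> setT) X isT isT (fun=> measurableT) mX.
by rewrite big_nil mule1 /tail_event/= set_nil bigcap_set0 setIT.
Qed.

End PartialSums.

Section AdditiveStatistics.
Context {R : realType} {d : measure_display} {T : measurableType d}.
Variables (P : probability T R) (xi : nat -> {RV P >-> R}).
Hypothesis xi_gauss : iid_std_gaussian xi.
Variable f : nat -> R -> R.
Hypothesis mf : forall k, measurable_fun setT (f k).

Let sum_stat n w := \sum_(k < n) f k (xi k w).

Let measurable_sum_stat n : measurable_fun setT (sum_stat n).
Proof.
by apply: measurable_sum => k; apply: measurableT_comp.
Qed.

Definition partial_sum n : {RV P >-> R} := mfun_Sub (mem_set (measurable_sum_stat n)).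

Lemma partial_sumE n w : partial_sum n w = \sum_(k < n) f k (xi k w).
Proof. by []. Qed.

Lemma partial_sumS n w :
  partial_sum n.+1 w = partial_sum n w + f n (xi n w).
Proof. by rewrite !partial_sumE big_ord_recr. Qed.

Let measurable_step n : measurable_fun setT (fun p : R * R => p.1 + f n p.2).
Proof. by apply: measurable_funD => //; exact: measurableT_comp. Qed.

Lemma partial_sum_independent n : independent_of_tail xi n (partial_sum n).
Proof.
elim: n => [|n IHn].
  have -> : (partial_sum 0 : T -> R) = fun=> 0.
    by apply/funext => w; rewrite partial_sumE big_ord0.
  exact: independent_of_tail0.
have -> : (partial_sum n.+1 : T -> R)
    = fun w => (fun p : R * R => p.1 + f n p.2) (partial_sum n w, xi n w).
  by apply/funext => w; rewrite partial_sumS.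
exact: (independent_of_tailS xi_gauss IHn (measurable_step n)).
Qed.

Lemma integral_partial_sumS n (g : R -> \bar R) :
  measurable_fun setT g -> (forall x, 0 <= g x)%E ->
  (\int[distribution P (partial_sum n.+1)]_s g s
   = \int[distribution P (partial_sum n)]_s
       \int[std_normal R]_x g (s + f n x)%R)%E.
Proof.
move=> mg g0; rewrite ge0_integral_distribution//.
transitivity (\int[P]_w g (partial_sum n w + f n (xi n w))%R)%E.
  by apply: eq_integral => w _; rewrite -partial_sumS.
rewrite -(@integral_next _ _ _ _ _ xi_gauss n (partial_sum n)
  (fun p => g (p.1 + f n p.2)))//.
- exact: partial_sum_independent.
- exact: (measurableT_comp mg (measurable_step n)).
Qed.

Lemma expectation_exp_partial_sum n :
  (\int[P]_w (expR (partial_sum n w))%:E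
   = \prod_(k < n) \int[std_normal R]_x (expR (f k x))%:E)%E.
Proof.
have mexp : measurable_fun setT (fun x : R => (expR x)%:E).
  by apply/measurable_EFinP.
have e0 (x : R) : (0 <= (expR x)%:E)%E by rewrite lee_fin expR_ge0.
rewrite -(ge0_integral_distribution (partial_sum n) mexp)//.
elim: n => [|n IHn].
  rewrite big_ord0 ge0_integral_distribution//=.
  rewrite (eq_integral (cst 1%E)); last first.
    by move=> w _; rewrite /= /sum_stat big_ord0 expR0.
  by rewrite integral_cst// mul1e; exact: probability_setT.
rewrite integral_partial_sumS// big_ord_recr/= -IHn -ge0_integralZr//; last first.
  by apply: integral_ge0.
apply: eq_integral => s _.
under eq_integral do rewrite expRD EFinM.
rewrite ge0_integralZl//.
by apply/measurable_EFinP; exact: measurableT_comp.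
Qed.

End AdditiveStatistics.

(** * Overlap of a law with an independent copy of itself *)

(* [measurable_funB] has to come before [measurable_funD], which also applies to a
   difference but leaves an opposite behind. *)
Ltac measurability := repeat first
  [ exact: measurable_cst | exact: measurable_id | exact: measurable_fst
  | exact: measurable_snd
  | apply: measurable_funB | apply: measurable_funD | apply: measurable_funM
  | apply: measurable_funX
  | apply: (measurableT_comp measurable_fst)
  | apply: (measurableT_comp measurable_snd) ].

Definition gauss_kernel (R : realType) (tau z : R) : R :=
  expR (- z ^+ 2 / (2 * tau)).

Section GaussKernel.
Context {R : realType}.
Implicit Types tau z c : R.

Lemma gauss_kernel_ge0 tau z : 0 <= gauss_kernel tau z.
Proof. exact: expR_ge0. Qed.

Lemma gauss_kernel_le1 tau z : 0 < tau -> gauss_kernel tau z <= 1.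
Proof.
move=> tau0; rewrite -[leRHS]expR0 ler_expR mulNr oppr_le0.
by rewrite divr_ge0 ?sqr_ge0// mulr_ge0// ltW.
Qed.

Lemma measurable_gauss_kernel tau : measurable_fun setT (gauss_kernel tau).
Proof.
apply: measurableT_comp => //; apply: measurable_funM => //.
by apply: measurableT_comp => //; exact: measurable_funX.
Qed.

Lemma continuous_gauss_kernel tau : continuous (gauss_kernel tau).
Proof.
move=> z; apply: (@continuous_comp _ _ _ (fun z : R => - z ^+ 2 / (2 * tau)) expR).
  apply: cvgM; last exact: cvg_cst.
  by apply: cvgN; exact: exprn_continuous.
exact: continuous_expR.
Qed.

(** Convolving Gaussian kernels adds their variances. *)
Lemma gauss_kernel_smoothing tau z c : 0 < tau ->
  (\int[std_normal R]_u (gauss_kernel tau (z + c * u))%:E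
   = ((Num.sqrt (1 + c ^+ 2 / tau))^-1 * gauss_kernel (tau + c ^+ 2) z)%:E)%E.
Proof.
move=> tau0.
have c2 : 0 <= c ^+ 2 := sqr_ge0 c.
pose a := c ^+ 2 / (2 * tau); pose b := - (z * c / tau).
have a0 : 0 <= a by rewrite divr_ge0// mulr_ge0// ltW.
transitivity (\int[std_normal R]_u
    ((gauss_kernel tau z)%:E * (expR (- a * u ^+ 2 + b * u))%:E))%E.
  apply: eq_integral => u _; rewrite -EFinM /gauss_kernel -expRD.
  by congr (expR _)%:E; rewrite /a /b; field; rewrite gt_eqF.
rewrite ge0_integralZl//; last 2 first.
- apply/measurable_EFinP; apply: measurableT_comp => //; measurability.
- by rewrite lee_fin gauss_kernel_ge0.
rewrite integral_gaussian_exp// -EFinM mulrCA.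
have -> : 1 + 2 * a = 1 + c ^+ 2 / tau by rewrite /a; field; rewrite gt_eqF.
congr (_ * _)%:E; rewrite /gauss_kernel -expRD; congr expR; rewrite /b.
have t1 : tau + c ^+ 2 != 0 by rewrite gt_eqF// ltr_pwDl.
by field; rewrite t1 gt_eqF.
Qed.

End GaussKernel.

Section Concentration.
Context {R : realType}.

(** This is [E (gauss_kernel tau (Z - Z'))] for independent [Z] and [Z'] of law
    [nu]; its size measures how much [nu] concentrates at scale [sqrt tau]. *)
Definition self_overlap (nu : probability R R) (tau : R) : \bar R :=
  (\int[nu]_s \int[nu]_t (gauss_kernel tau (s - t))%:E)%E.

(** Here [nu'] is the law of [Z + w xi^2] with [xi] a standard Gaussian independent
    of [Z]. Two independent copies differ by [s - t + w (x^2 - y^2)], which the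
    rotation makes conditionally Gaussian given [v]. *)
Lemma self_overlap_add_square (nu nu' : probability R R) (w tau : R) :
  (forall g : R -> \bar R, measurable_fun setT g -> (forall x, 0 <= g x)%E ->
     (\int[nu']_s g s = \int[nu]_s \int[std_normal R]_x g (s + w * x ^+ 2)%R)%E) ->
  0 < tau ->
  (self_overlap nu' tau
   = \int[std_normal R]_v \int[nu]_s \int[nu]_t \int[std_normal R]_u
       (gauss_kernel tau (s - t + 2 * w * v * u))%:E)%E.
Proof.
move=> nu'E tau0; set K := gauss_kernel tau.
have K0 p : (0 <= (K p)%:E)%E by rewrite lee_fin gauss_kernel_ge0.
have mK d (T : measurableType d) (h : T -> R) : measurable_fun setT h ->
    measurable_fun setT (fun p => (K (h p))%:E).
  move=> mh; apply/measurable_EFinP.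
  by apply: (measurableT_comp _ mh); exact: measurable_gauss_kernel.
have mpar d1 d2 (T1 : measurableType d1) (T2 : measurableType d2)
    (m : probability T2 R) (F : T1 * T2 -> \bar R) :
    measurable_fun setT F -> (forall p, 0 <= F p)%E ->
    measurable_fun setT (fun x => \int[m]_y F (x, y))%E.
  by move=> mF F0; exact: (@measurable_fun_fubini_tonelli_F _ _ _ _ _ m F).
rewrite /self_overlap nu'E; last 2 first.
- apply: (mpar _ _ _ _ nu' (fun p : R * R => (K (p.1 - p.2))%:E)) => //.
  by apply: mK; measurability.
- by move=> s; apply: integral_ge0.
transitivity (\int[nu]_s \int[std_normal R]_x \int[nu]_t \int[std_normal R]_y
    (K (s + w * x ^+ 2 - (t + w * y ^+ 2)))%:E)%E.
  apply: eq_integral => s _; apply: eq_integral => x _.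
  rewrite (nu'E (fun t => (K (s + w * x ^+ 2 - t))%:E))//.
  by apply: mK; measurability.
transitivity (\int[nu]_s \int[nu]_t \int[std_normal R]_x \int[std_normal R]_y
    (K (s + w * x ^+ 2 - (t + w * y ^+ 2)))%:E)%E.
  apply: eq_integral => s _.
  apply: (fubini_tonelli (m1 := std_normal R) (m2 := nu) (fun p : R * R =>
    \int[std_normal R]_y (K (s + w * p.1 ^+ 2 - (p.2 + w * y ^+ 2)))%:E)%E).
    apply: (mpar _ _ _ _ (std_normal R) (fun q : (R * R) * R =>
      (K (s + w * q.1.1 ^+ 2 - (q.1.2 + w * q.2 ^+ 2)))%:E)) => //.
    by apply: mK; measurability.
  by move=> p; apply: integral_ge0.
transitivity (\int[nu]_s \int[nu]_t \int[std_normal R]_v \int[std_normal R]_u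
    (K (s - t + 2 * w * v * u))%:E)%E.
  apply: eq_integral => s _; apply: eq_integral => t _.
  transitivity (\int[std_normal R]_x \int[std_normal R]_y
      (K (s - t + w * (x ^+ 2 - y ^+ 2)))%:E)%E.
    apply: eq_integral => x _; apply: eq_integral => y _.
    by congr (K _)%:E; ring.
  rewrite (@gaussian_rotation R (fun r => K (s - t + w * r))).
  - apply: eq_integral => v _; apply: eq_integral => u _.
    by congr (K _)%:E; ring.
  - move=> r; apply: (@continuous_comp _ _ _ (fun r : R => s - t + w * r) K).
      by apply: cvgD; [exact: cvg_cst|apply: cvgM; [exact: cvg_cst|exact: cvg_id]].
    exact: continuous_gauss_kernel.
  - by move=> r; exact: gauss_kernel_ge0.
transitivity (\int[nu]_s \int[std_normal R]_v \int[nu]_t \int[std_normal R]_u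
    (K (s - t + 2 * w * v * u))%:E)%E.
  apply: eq_integral => s _.
  apply: (fubini_tonelli (m1 := nu) (m2 := std_normal R) (fun p : R * R =>
    \int[std_normal R]_u (K (s - p.1 + 2 * w * p.2 * u))%:E)%E).
    apply: (mpar _ _ _ _ (std_normal R) (fun q : (R * R) * R =>
      (K (s - q.1.1 + 2 * w * q.1.2 * q.2))%:E)) => //.
    by apply: mK; measurability.
  by move=> p; apply: integral_ge0.
apply: (fubini_tonelli (m1 := nu) (m2 := std_normal R) (fun p : R * R =>
  \int[nu]_t \int[std_normal R]_u (K (p.1 - t + 2 * w * p.2 * u))%:E)%E).
  apply: (mpar _ _ _ _ nu (fun q : (R * R) * R =>
    \int[std_normal R]_u (K (q.1.1 - q.2 + 2 * w * q.1.2 * u))%:E)%E) => //.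
    apply: (mpar _ _ _ _ (std_normal R) (fun r : ((R * R) * R) * R =>
      (K (r.1.1.1 - r.1.2 + 2 * w * r.1.1.2 * r.2))%:E)) => //.
    by apply: mK; measurability.
  by move=> q; apply: integral_ge0.
by move=> p; apply: integral_ge0 => t _; apply: integral_ge0.
Qed.

End Concentration.

(** The integral of a nonnegative function is a supremum over the simple functions
    below it, so monotonicity holds for arbitrary functions; this spares the
    measurability of iterated integrals. *)
Lemma ge0_integral_monotone d (T : measurableType d) (R : realType)
    (mu : {measure set T -> \bar R}) (f g : T -> \bar R) :
  (forall x, 0 <= f x)%E -> (forall x, f x <= g x)%E ->
  (\int[mu]_x f x <= \int[mu]_x g x)%E.
Proof.
move=> f0 fg; rewrite !ge0_integralTE//; last by move=> x; exact: le_trans (fg x).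
apply: le_ereal_sup; apply: image_subset => h /= hf x.
exact: le_trans (hf x) (fg x).
Qed.

Lemma integral_cst_probability d (T : measurableType d) (R : realType)
    (nu : probability T R) (r : R) : (\int[nu]_x r%:E = r%:E)%E.
Proof.
by rewrite integral_cst// -[RHS]mule1; congr (_ * _)%E; exact: probability_setT.
Qed.

Section OverlapBound.
Context {R : realType}.

Lemma self_overlap_le1 (nu : probability R R) (tau : R) :
  0 < tau -> (self_overlap nu tau <= 1)%E.
Proof.
move=> tau0; rewrite -(integral_cst_probability nu 1).
apply: ge0_integral_monotone => s.
  by apply: integral_ge0 => t _; rewrite lee_fin gauss_kernel_ge0.
rewrite -(integral_cst_probability nu 1).
apply: ge0_integral_monotone => t; rewrite lee_fin.
  exact: gauss_kernel_ge0.
exact: gauss_kernel_le1.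
Qed.

Variables (tau0 kappa : R).
Hypotheses (tau0_gt0 : 0 < tau0) (kappa_gt0 : 0 < kappa).

(** The self-overlap after [n] additions is an average of
    [sqrt tau / sqrt (tau + Y)] over a random variance [Y]. A family of majorants
    stable under [tau -> tau + 4 w^2 v^2] is needed to bound it by induction;
    exponentials in [tau] are such, as a Gaussian average of [expR (- a * v ^+ 2)]
    is explicit, and the constant [B] takes care of [tau > kappa]. *)
Definition overlap_decay (nu : probability R R) (A B : R) : Prop :=
  forall tau, tau0 <= tau ->
  (self_overlap nu tau
    <= (Num.sqrt tau * (A * expR (- tau / kappa) + B))%:E)%E.

(** Given [v], smoothing replaces [tau] by [tau + (2 w v)^2], at which the bound
    for [nu] applies. The factors [sqrt tau] match, and averaging
    [exp (- 4 w^2 v^2 / kappa)] over [v] yields the factor gained in [A]. *)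
Lemma overlap_decay_add_square (nu nu' : probability R R) (w A B : R) :
  (forall g : R -> \bar R, measurable_fun setT g -> (forall x, 0 <= g x)%E ->
     (\int[nu']_s g s = \int[nu]_s \int[std_normal R]_x g (s + w * x ^+ 2)%R)%E) ->
  0 <= A -> 0 <= B ->
  overlap_decay nu A B ->
  overlap_decay nu' (A * (Num.sqrt (1 + 8 * w ^+ 2 / kappa))^-1) B.
Proof.
move=> nu'E A0 B0 decay tau tau0tau.
have tau_gt0 : 0 < tau := lt_le_trans tau0_gt0 tau0tau.
have le_of_eq (x y : R) : x = y -> x <= y by move=> ->.
have st0 : 0 <= Num.sqrt tau := sqrtr_ge0 tau.
rewrite (self_overlap_add_square nu'E)//.
pose a := 4 * w ^+ 2 / kappa.
have a0 : 0 <= a by rewrite /a divr_ge0 ?(ltW kappa_gt0)// mulr_ge0 ?ler0n ?sqr_ge0.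
apply: (@le_trans _ _ (\int[std_normal R]_v
   ((Num.sqrt tau * (A * expR (- tau / kappa)))%:E
      * (expR (- a * v ^+ 2 + 0 * v))%:E + (Num.sqrt tau * B)%:E)))%E.
  apply: ge0_integral_monotone => v.
    apply: integral_ge0 => s _; apply: integral_ge0 => t _.
    by apply: integral_ge0 => u _; rewrite lee_fin gauss_kernel_ge0.
  pose c := 2 * w * v; pose q := (Num.sqrt (1 + c ^+ 2 / tau))^-1.
  have q0 : 0 <= q by rewrite invr_ge0 sqrtr_ge0.
  have c2 : 0 <= c ^+ 2 := sqr_ge0 c.
  have -> : (\int[nu]_s \int[nu]_t \int[std_normal R]_u
      (gauss_kernel tau (s - t + 2 * w * v * u))%:E
      = q%:E * self_overlap nu (tau + c ^+ 2))%E.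
    rewrite /self_overlap -ge0_integralZl//; last 2 first.
    - apply: (@measurable_fun_fubini_tonelli_F _ _ _ _ _ nu
        (fun p : R * R => (gauss_kernel (tau + c ^+ 2) (p.1 - p.2))%:E)).
        apply/measurable_EFinP; apply: measurableT_comp.
          exact: measurable_gauss_kernel.
        by measurability.
      by move=> p; rewrite lee_fin gauss_kernel_ge0.
    - by move=> s _; apply: integral_ge0 => t _; rewrite lee_fin gauss_kernel_ge0.
    apply: eq_integral => s _; rewrite -ge0_integralZl//; last 2 first.
    - apply/measurable_EFinP; apply: measurableT_comp.
        exact: measurable_gauss_kernel.
      by measurability.
    - by move=> t _; rewrite lee_fin gauss_kernel_ge0.
    by apply: eq_integral => t _; rewrite gauss_kernel_smoothing// EFinM.
  apply: le_trans (lee_wpmul2l _ (decay (tau + c ^+ 2) _)) _.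
  - by rewrite lee_fin.
  - by rewrite (le_trans tau0tau)// lerDl.
  rewrite -!EFinM -EFinD lee_fin mulrA.
  have -> : q * Num.sqrt (tau + c ^+ 2) = Num.sqrt tau.
    rewrite /q (_ : tau + c ^+ 2 = (1 + c ^+ 2 / tau) * tau); last first.
      by field; rewrite gt_eqF.
    have h0 : 0 < 1 + c ^+ 2 / tau by rewrite ltr_pwDl// divr_ge0// ltW.
    by rewrite sqrtrM ?ltW// mulrA mulVf ?mul1r// gt_eqF// sqrtr_gt0.
  rewrite mulrDr lerD2r -mulrA ler_wpM2l// -mulrA ler_wpM2l// -expRD ler_expR.
  apply: le_of_eq; rewrite /a /c; field.
  by rewrite gt_eqF.
rewrite ge0_integralD//; last 3 first.
- by move=> v _; rewrite mule_ge0 ?lee_fin ?expR_ge0// !mulr_ge0 ?expR_ge0.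
- apply: emeasurable_funM => //; apply/measurable_EFinP.
  by apply: measurableT_comp => //; measurability.
- by move=> v _; rewrite lee_fin mulr_ge0.
rewrite integral_cst_probability ge0_integralZl//; last 2 first.
- apply/measurable_EFinP.
  by apply: measurableT_comp => //; measurability.
- by rewrite lee_fin !mulr_ge0 ?expR_ge0.
rewrite integral_gaussian_exp// expr0n/= mul0r expR0 mulr1 -EFinM -EFinD lee_fin.
apply: le_of_eq; have -> : 1 + 2 * a = 1 + 8 * w ^+ 2 / kappa.
  by rewrite /a; field; rewrite gt_eqF.
by ring.
Qed.

End OverlapBound.

Lemma prod_invsqrt_le (R : realType) (a : nat -> R) (n : nat) :
  (forall k, 0 <= a k) ->
  \prod_(k < n) (Num.sqrt (1 + a k))^-1 <= (Num.sqrt (1 + \sum_(k < n) a k))^-1.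
Proof.
move=> a0; elim: n => [|n IHn].
  by rewrite !big_ord0 addr0 sqrtr1 invr1.
rewrite !big_ord_recr/=; set s := \sum_(k < n) a k in IHn *.
have s0 : 0 <= s by rewrite /s sumr_ge0.
have an0 := a0 n.
apply: (le_trans (ler_wpM2r _ IHn)); first by rewrite invr_ge0 sqrtr_ge0.
rewrite -invfM lef_pV2 ?posrE ?mulr_gt0 ?sqrtr_gt0; try lra.
rewrite -sqrtrM; last lra.
rewrite ler_wsqrtr//; nra.
Qed.

Section IntervalOverlap.
Context {R : realType}.

(** On a set of diameter [delta] the kernel of variance [delta^2] is at least
    [exp (- 1/2)]. *)
Lemma sqr_measure_le_overlap (nu : probability R R) (I : set R) (delta : R) :
  measurable I -> 0 < delta ->
  (forall s t, I s -> I t -> `|s - t| <= delta) ->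
  (nu I * nu I <= (expR 2^-1)%:E * self_overlap nu (delta ^+ 2))%E.
Proof.
move=> mI delta0 Idelta.
have d2 : 0 < delta ^+ 2 by rewrite exprn_gt0.
have -> : (nu I * nu I = \int[nu]_s \int[nu]_t (\1_I s * \1_I t)%:E)%E.
  have nuI : nu I = (\int[nu]_s (\1_I s)%:E)%E by rewrite integral_indic// setIT.
  have mind : measurable_fun setT (fun s => (\1_I s : R)%:E).
    exact/measurable_EFinP/measurable_indic.
  rewrite {1}nuI -ge0_integralZr//; apply: eq_integral => s _.
  by rewrite nuI -ge0_integralZl ?lee_fin//.
rewrite /self_overlap -ge0_integralZl ?lee_fin ?expR_ge0//; last 2 first.
- apply: (@measurable_fun_fubini_tonelli_F _ _ _ _ _ nu
    (fun p : R * R => (gauss_kernel (delta ^+ 2) (p.1 - p.2))%:E)).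
    apply/measurable_EFinP; apply: measurableT_comp.
      exact: measurable_gauss_kernel.
    by measurability.
  by move=> p; rewrite lee_fin gauss_kernel_ge0.
- by move=> s _; apply: integral_ge0 => t _; rewrite lee_fin gauss_kernel_ge0.
apply: ge0_integral_monotone => s.
  by apply: integral_ge0 => t _; rewrite lee_fin mulr_ge0.
rewrite -ge0_integralZl ?lee_fin ?expR_ge0//; last 2 first.
- apply/measurable_EFinP; apply: measurableT_comp.
    exact: measurable_gauss_kernel.
  by measurability.
- by move=> t _; rewrite lee_fin gauss_kernel_ge0.
apply: ge0_integral_monotone => t; first by rewrite lee_fin mulr_ge0.
rewrite -EFinM lee_fin !indicE.
have [|_] := boolP (s \in I); last by rewrite mul0r mulr_ge0 ?expR_ge0.
rewrite inE => Is.
have [|_] := boolP (t \in I); last by rewrite mulr0 mulr_ge0 ?expR_ge0.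
rewrite inE => It.
rewrite mulr1 /gauss_kernel -expRD -[leLHS]expR0 ler_expR mulNr subr_ge0.
rewrite ler_pdivrMr ?mulr_gt0// mulrA mulVf ?mul1r ?pnatr_eq0//.
by rewrite -[leLHS]real_normK ?num_real// lerXn2r ?nnegrE ?(ltW delta0)// Idelta.
Qed.

End IntervalOverlap.

(** * Anticoncentration of weighted chi-squares *)

Section WeightedChiSquare.
Context {R : realType} {d : measure_display} {T : measurableType d}.
Variables (P : probability T R) (xi : nat -> {RV P >-> R}).
Hypothesis xi_gauss : iid_std_gaussian xi.
Variable w : nat -> R.

Let square_term (k : nat) (x : R) := w k * x ^+ 2.

Let measurable_square_term k : measurable_fun setT (square_term k).
Proof. by apply: measurable_funM => //; exact: measurable_funX. Qed.

Let chi2 := partial_sum xi measurable_square_term.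

(* For [n = 0] the overlap is at most 1; the first term of the majorant is at
   least 1 for [tau0 <= tau <= kappa], the second one for [kappa <= tau]. *)
Let overlap_decay_chi2 (tau0 kappa : R) (n : nat) : 0 < tau0 -> 0 < kappa ->
  overlap_decay tau0 kappa (distribution P (chi2 n))
    ((Num.sqrt tau0)^-1 * expR 1
      * \prod_(k < n) (Num.sqrt (1 + 8 * w k ^+ 2 / kappa))^-1)
    (Num.sqrt kappa)^-1.
Proof.
move=> tau00 kappa0; elim: n => [|n IHn].
  move=> tau tau0tau; have taugt0 := lt_le_trans tau00 tau0tau.
  apply: (le_trans (self_overlap_le1 _ taugt0)); rewrite big_ord0 mulr1 lee_fin.
  have st : Num.sqrt tau0 <= Num.sqrt tau by rewrite ler_wsqrtr.
  have st0 : 0 < Num.sqrt tau0 by rewrite sqrtr_gt0.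
  have sk0 : 0 < Num.sqrt kappa by rewrite sqrtr_gt0.
  rewrite mulrDr; have [tk|kt] := leP tau kappa.
    rewrite -[leLHS]addr0; apply: lerD; last by rewrite mulr_ge0 ?invr_ge0// ltW.
    rewrite -mulrA -expRD mulrA -[leLHS]mulr1 ler_pM//.
      by rewrite ler_pdivlMr// mul1r.
    rewrite -[leLHS]expR0 ler_expR mulNr subr_ge0 ler_pdivrMr// mul1r//.
  rewrite -[leLHS]add0r; apply: lerD.
    by rewrite !mulr_ge0 ?invr_ge0 ?expR_ge0// ltW.
  by rewrite ler_pdivlMr// mul1r ler_wsqrtr// ltW.
rewrite big_ord_recr/= mulrA.
apply: (overlap_decay_add_square tau00 kappa0 _ _ _ IHn).
- by move=> g mg g0;
    exact: (integral_partial_sumS xi_gauss measurable_square_term n mg g0).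
- by rewrite !mulr_ge0 ?invr_ge0 ?expR_ge0 ?sqrtr_ge0// prodr_ge0.
- by rewrite invr_ge0 sqrtr_ge0.
Qed.

Definition anticoncentration_const : R := expR 2^-1 * (expR 1 + 1).

(** The decay bound is used at [tau0 = (delta W)^2] and [kappa = delta W^2]. The
    product of the factors is at most [(1 + 8 W^2 / kappa)^(-1/2)], of order
    [sqrt delta], and [sqrt (tau0 / kappa)] equals [sqrt delta]: this choice of
    [kappa] balances the two terms. *)
Lemma weighted_chi2_anticoncentration (n : nat) (a delta : R) :
  let W := Num.sqrt (\sum_(k < n) w k ^+ 2) in
  let I := [set om | a < \sum_(k < n) w k * xi k om ^+ 2 <= a + delta * W] in
  0 < W -> 0 < delta ->
  (P I * P I <= (anticoncentration_const * Num.sqrt delta)%:E)%E.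
Proof.
move=> W I W0 delta0.
pose nu : probability R R := distribution P (chi2 n).
pose J := `]a, (a + delta * W)]%classic.
have -> : P I = nu J.
  by congr (P _); apply/seteqP; split => om; rewrite /I /J /= in_itv.
have dW0 : 0 < delta * W by rewrite mulr_gt0.
have kappa0 : 0 < delta * W ^+ 2 by rewrite mulr_gt0// exprn_gt0.
have tau00 : 0 < (delta * W) ^+ 2 by rewrite exprn_gt0.
apply: le_trans (sqr_measure_le_overlap (delta := delta * W) _ _ _ _) _ => //.
- exact: measurable_itv.
- by move=> s t; rewrite /J /= !in_itv/= => /andP[? ?] /andP[? ?]; rewrite ler_norml; lra.
rewrite /anticoncentration_const -mulrA EFinM lee_wpmul2l ?lee_fin ?expR_ge0//.
apply: le_trans (overlap_decay_chi2 n tau00 kappa0 (lexx _)) _.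
rewrite lee_fin sqrtr_sqr gtr0_norm// mulrDr mulrDl; apply: lerD.
  rewrite [leLHS](_ : _ = expR 1 * (\prod_(k < n)
      (Num.sqrt (1 + 8 * w k ^+ 2 / (delta * W ^+ 2)))^-1 *
      expR (- (delta * W) ^+ 2 / (delta * W ^+ 2)))); last first.
    by field; rewrite !gt_eqF.
  rewrite ler_wpM2l ?expR_ge0// -[leRHS]mulr1 ler_pM ?expR_ge0//.
  - by rewrite prodr_ge0// => k _; rewrite invr_ge0 sqrtr_ge0.
  - apply: le_trans (@prod_invsqrt_le R (fun k => 8 * w k ^+ 2 / (delta * W ^+ 2)) n _) _.
      by move=> k; rewrite divr_ge0 ?(ltW kappa0)// mulr_ge0 ?ler0n ?sqr_ge0.
    rewrite -mulr_suml -mulr_sumr.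
    have -> : \sum_(k < n) w k ^+ 2 = W ^+ 2.
      by rewrite sqr_sqrtr// sumr_ge0// => k _; exact: sqr_ge0.
    rewrite -sqrtrV ?ler_wsqrtr//; last first.
      by rewrite addr_ge0// divr_ge0 ?(ltW kappa0)// mulr_ge0 ?ler0n ?sqr_ge0.
    have -> : 1 + 8 * W ^+ 2 / (delta * W ^+ 2) = (delta + 8) / delta.
      by field; rewrite !gt_eqF.
    rewrite invf_div ler_pdivrMr; last by rewrite addr_gt0.
    by nra.
  - by rewrite -[leRHS]expR0 ler_expR mulNr oppr_le0 divr_ge0 ?sqr_ge0// ltW.
rewrite mul1r sqrtrM ?(ltW delta0)// sqrtr_sqr gtr0_norm//.
rewrite invfM mulrACA divff ?gt_eqF// mulr1.
by rewrite ler_pdivrMr ?sqrtr_gt0// -expr2 sqr_sqrtr// ltW.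
Qed.

End WeightedChiSquare.

(** * Chernoff bounds *)

Section ChernoffBounds.
Context {R : realType} {d : measure_display} {T : measurableType d}.
Variables (P : probability T R) (xi : nat -> {RV P >-> R}).
Hypothesis xi_gauss : iid_std_gaussian xi.

Lemma chernoff_additive (f : nat -> R -> R) (h : nat -> R) (n : nat) (a : R) :
  (forall k, measurable_fun setT (f k)) ->
  (forall k, (\int[std_normal R]_x (expR (f k x))%:E = (h k)%:E)%E) ->
  (P [set om | (a <= \sum_(k < n) f k (xi k om))%R]
    <= (\prod_(k < n) h k * expR (- a))%:E)%E.
Proof.
move=> mf hE.
have := chernoff (partial_sum xi mf n) a (@ltr01 R); rewrite mul1r.
move=> H; apply: (le_trans H); rewrite EFinM; apply: lee_wpmul2r.
  by rewrite lee_fin expR_ge0.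
rewrite /mmt_gen_fun unlock.
under eq_integral do rewrite /= mulr1.
have := expectation_exp_partial_sum xi_gauss mf n => /= ->.
by rewrite (eq_bigr (fun k : 'I_n => (h k)%:E)) ?prodEFin// => k _; rewrite hE.
Qed.

Variables (w mu : nat -> R) (n : nat).
Hypothesis w_ge0 : forall k, 0 <= w k.

Let W := Num.sqrt (\sum_(k < n) w k ^+ 2).
Let m := \sum_(k < n) w k * mu k ^+ 2.

Hypothesis W_gt0 : 0 < W.

Let W2E : W ^+ 2 = \sum_(k < n) w k ^+ 2.
Proof. by rewrite sqr_sqrtr// sumr_ge0// => k _; exact: sqr_ge0. Qed.

Let weight_le (k : 'I_n) : w k <= W.
Proof.
rewrite -[leLHS]ger0_norm// -sqrtr_sqr ler_wsqrtr//.
rewrite (bigD1 k)//= lerDl sumr_ge0// => j _; exact: sqr_ge0.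
Qed.

(* From [1 - z <= expR (- z)] at [z = u / (1 + u)], as [u - u ^+ 2 <= z]. *)
Let expR_sub_sqr_le (u : R) : 0 <= u -> expR (u - u ^+ 2) <= 1 + u.
Proof.
move=> u0; have u1 : 0 < 1 + u by lra.
apply: (@le_trans _ _ (expR (u / (1 + u)))).
  rewrite ler_expR ler_pdivlMr//; nra.
rewrite -[leLHS]invrK -expRN -[leRHS]invrK lef_pV2 ?posrE ?invr_gt0 ?expR_gt0//.
apply: le_trans (expR_ge1Dx _).
by rewrite le_eqVlt; apply/orP; left; apply/eqP; field; rewrite gt_eqF.
Qed.

(** Chernoff's bound with parameter [1 / (4 W)]. Since no weight exceeds [W], each
    [l k] is at most [1/4], so that half of the contribution [l_k mu_k^2] of the
    signal survives in the exponent; the noise contributes [2 l_k^2], which sums to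
    [1/8]. *)
Lemma noncentral_chi2_lower_tail (c x : R) : x * W <= m ->
  (P [set om | (\sum_(k < n) w k * ((mu k + xi k om) ^+ 2 - 1) <= c * W)%R]
    <= (expR (c / 4 + 1 / 8 - x / 8))%:E)%E.
Proof.
move=> xWm.
pose l k := w k / (4 * W).
have l0 k : 0 <= l k by rewrite /l divr_ge0// mulr_ge0 ?ler0n// ltW.
pose f k (x : R) := - l k * ((mu k + x) ^+ 2 - 1).
pose h k := expR (l k - l k * mu k ^+ 2) *
  ((Num.sqrt (1 + 2 * l k))^-1 *
   expR ((- (2 * l k * mu k)) ^+ 2 / (2 * (1 + 2 * l k)))).
have mf k : measurable_fun setT (f k) by measurability.
have hE k : (\int[std_normal R]_x (expR (f k x))%:E = (h k)%:E)%E.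
  rewrite /h [in RHS]EFinM -integral_gaussian_exp// -ge0_integralZl//.
  - apply: eq_integral => y _; rewrite -EFinM -expRD; congr (expR _)%:E.
    by rewrite /f; ring.
  - by apply/measurable_EFinP; apply: measurableT_comp => //; measurability.
have -> : [set om | \sum_(k < n) w k * ((mu k + xi k om) ^+ 2 - 1) <= c * W]
    = [set om | - (c / 4) <= \sum_(k < n) f k (xi k om)].
  apply/seteqP; split=> om /=;
    rewrite (_ : \sum_(k < n) f k (xi k om) =
      - ((\sum_(k < n) w k * ((mu k + xi k om) ^+ 2 - 1)) / (4 * W))).
  - rewrite lerN2 ler_pdivrMr ?mulr_gt0//; lra.
  - by rewrite mulr_suml -sumrN; apply: eq_bigr => k _; rewrite /f /l; ring.
  - rewrite lerN2 ler_pdivrMr ?mulr_gt0//; lra.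
  - by rewrite mulr_suml -sumrN; apply: eq_bigr => k _; rewrite /f /l; ring.
apply: le_trans (chernoff_additive n _ mf hE) _.
rewrite lee_fin opprK.
apply: (@le_trans _ _ (\prod_(k < n) expR (2 * l k ^+ 2 - l k * mu k ^+ 2 / 2)
    * expR (c / 4))).
  rewrite ler_wpM2r ?expR_ge0//; apply: ler_prod => k _.
  rewrite /h !mulr_ge0 ?invr_ge0 ?expR_ge0 ?sqrtr_ge0//=.
  have lk := l0 k; have l4 : l k <= 4^-1.
    rewrite /l ler_pdivrMr ?mulr_gt0//; have := weight_le k; lra.
  have m2 : 0 <= mu k ^+ 2 := sqr_ge0 _.
  have s0 : 0 < 1 + 2 * l k by lra.
  have sq : (Num.sqrt (1 + 2 * l k))^-1 <= expR (2 * l k ^+ 2 - l k).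
    rewrite -[leRHS]invrK -expRN lef_pV2 ?posrE ?invr_gt0 ?expR_gt0 ?sqrtr_gt0//.
    rewrite -[leLHS]ger0_norm ?expR_ge0// -sqrtr_sqr ler_wsqrtr//.
    have := @expR_sub_sqr_le (2 * l k); rewrite mulr_ge0 ?ler0n// => /(_ isT).
    by apply: le_trans; rewrite expr2 -expRD ler_expR; lra.
  rewrite mulrCA.
  apply: (le_trans (ler_wpM2r _ sq)); first by rewrite mulr_ge0 ?expR_ge0.
  rewrite -!expRD ler_expR.
  have : (- (2 * l k * mu k)) ^+ 2 / (2 * (1 + 2 * l k)) <= l k * mu k ^+ 2 / 2.
    rewrite ler_pdivrMr ?mulr_gt0//.
    have p1 : 0 <= 1 - 2 * l k by lra.
    have := mulr_ge0 (mulr_ge0 lk m2) p1.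
    by nra.
  by lra.
rewrite -expR_sum -expRD ler_expR.
have -> : \sum_(k < n) (2 * l k ^+ 2 - l k * mu k ^+ 2 / 2)
    = 2 * W ^+ 2 / (4 * W) ^+ 2 - m / (8 * W).
  rewrite sumrB W2E /m mulr_sumr !mulr_suml; congr (_ - _);
  by apply: eq_bigr => k _; rewrite /l; field; rewrite gt_eqF.
have -> : 2 * W ^+ 2 / (4 * W) ^+ 2 = 1 / 8 by field; rewrite gt_eqF.
have : x / 8 <= m / (8 * W).
  rewrite ler_pdivlMr ?mulr_gt0//; lra.
by lra.
Qed.

(** The variance [4 \sum_k w_k^2 mu_k^2] of the linear term is at most [4 W m], as no
    weight exceeds [W]; the bound is Chernoff's with parameter [s / W]. *)
Lemma gaussian_shift_upper_tail (C s dlt : R) : 0 < s -> m <= C * W ->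
  (P [set om | (dlt * W <= m + 2 * \sum_(k < n) w k * mu k * xi k om)%R]
    <= (expR (2 * s ^+ 2 * C + s * C - s * dlt))%:E)%E.
Proof.
move=> s0 mC.
pose a k := 2 * (s / W) * w k * mu k.
pose f k (x : R) := a k * x.
pose h k := expR (a k ^+ 2 / 2).
have mf k : measurable_fun setT (f k) by measurability.
have hE k : (\int[std_normal R]_x (expR (f k x))%:E = (h k)%:E)%E.
  have := @integral_gaussian_exp R 0 (a k) (lexx _).
  rewrite mulr0 addr0 sqrtr1 invr1 mul1r mulr1 => <-.
  by apply: eq_integral => x _; rewrite oppr0 mul0r add0r.
have sW : 0 < s / W by rewrite divr_gt0.
have -> : [set om | (dlt * W <= m + 2 * \sum_(k < n) w k * mu k * xi k om)%R]
    = [set om | (s / W * (dlt * W - m) <= \sum_(k < n) f k (xi k om))%R].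
  apply/seteqP; split=> om /=;
    rewrite (_ : \sum_(k < n) f k (xi k om) =
      (s / W) * (2 * \sum_(k < n) w k * mu k * xi k om)).
  - by rewrite ler_pM2l//; lra.
  - by rewrite !mulr_sumr; apply: eq_bigr => k _; rewrite /f /a; ring.
  - by rewrite ler_pM2l//; lra.
  - by rewrite !mulr_sumr; apply: eq_bigr => k _; rewrite /f /a; ring.
apply: le_trans (chernoff_additive n _ mf hE) _.
rewrite lee_fin -expR_sum -expRD ler_expR.
have : \sum_(k < n) a k ^+ 2 / 2 <= 2 * (s / W) ^+ 2 * (W * m).
  rewrite /m !mulr_sumr; apply: ler_sum => k _.
  rewrite /a (_ : _ / 2 = 2 * (s / W) ^+ 2 * (w k * (w k * mu k ^+ 2))); 
    last by field; rewrite gt_eqF.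
  apply: ler_wpM2l; first by rewrite mulr_ge0 ?ler0n ?sqr_ge0.
  apply: ler_wpM2r; last exact: weight_le.
  by rewrite mulr_ge0 ?sqr_ge0.
have -> : 2 * (s / W) ^+ 2 * (W * m) = 2 * s ^+ 2 * (m / W).
  by field; rewrite gt_eqF.
have -> : s / W * (dlt * W - m) = s * dlt - s * (m / W).
  by field; rewrite gt_eqF.
have mW : m / W <= C by rewrite ler_pdivrMr.
have : 2 * s ^+ 2 * (m / W) <= 2 * s ^+ 2 * C.
  by rewrite ler_wpM2l// mulr_ge0 ?sqr_ge0.
have : s * (m / W) <= s * C by rewrite ler_wpM2l// ltW.
by lra.
Qed.

End ChernoffBounds.

(** * Miss probability against signal strength *)

Lemma expR_opp_inv_le (R : realType) (x : R) : 0 < x -> expR (- x^-1) <= x.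
Proof.
move=> x0; rewrite expRN -[leRHS]invrK lef_pV2 ?posrE ?expR_gt0 ?invr_gt0//.
by apply: le_trans (expR_ge1Dx _); rewrite lerDr.
Qed.

Section Detection.
Context {R : realType} {d : measure_display} {T : measurableType d}.
Variables (P : probability T R) (xi : nat -> {RV P >-> R}).
Hypothesis xi_gauss : iid_std_gaussian xi.

(** The slack [1/2 - beta] is shared equally between the anticoncentration event
    and the Gaussian shift. The width [delta] is such that the first has
    probability at most [eta]. Then [s] and the resulting constant turn the bound
    [exp (C (2 s^2 + s) - s delta)] on the second into [exp (- 1 / eta)]. *)
Definition lower_const (beta : R) : R :=
  let eta := (2^-1 - beta) / 2 in
  let delta := (eta ^+ 2 / anticoncentration_const) ^+ 2 in
  let s := 2 / (delta * eta) in
  eta^-1 / (2 * s ^+ 2 + s).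

(** At signal strength [x = upper_const beta c] the exponent [c/4 + 1/8 - x/8] equals
    [- 1 / beta]. *)
Definition upper_const (beta c : R) : R := 2 * c + 1 + 8 / beta.

Lemma anticoncentration_const_gt0 : 0 < anticoncentration_const :> R.
Proof. by rewrite mulr_gt0 ?expR_gt0// addr_gt0 ?expR_gt0. Qed.

Lemma lower_const_gt0 (beta : R) : beta < 2^-1 -> 0 < lower_const beta.
Proof.
move=> b2; have eta0 : 0 < (2^-1 - beta) / 2 by lra.
rewrite /lower_const/=; set eta := (2^-1 - beta) / 2 in eta0 *.
set delta := (eta ^+ 2 / _) ^+ 2.
have delta0 : 0 < delta.
  by rewrite /delta exprn_gt0// divr_gt0 ?anticoncentration_const_gt0// exprn_gt0.
have s0 : 0 < 2 / (delta * eta) by rewrite divr_gt0// mulr_gt0.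
by rewrite divr_gt0 ?invr_gt0// addr_gt0// mulr_gt0// exprn_gt0.
Qed.

Variables (w mu : nat -> R) (n : nat).
Hypothesis w_ge0 : forall k, 0 <= w k.

Let W := Num.sqrt (\sum_(k < n) w k ^+ 2).
Let m := \sum_(k < n) w k * mu k ^+ 2.
Let Q om := \sum_(k < n) w k * (xi k om ^+ 2 - 1).
Let S om := \sum_(k < n) w k * ((mu k + xi k om) ^+ 2 - 1).

Let W_eq0 : W = 0 -> forall k : 'I_n, w k = 0.
Proof.
move=> /eqP; rewrite sqrtr_eq0 => W0 k; apply/eqP.
have : \sum_(k < n) w k ^+ 2 == 0.
  by rewrite eq_le W0 sumr_ge0// => j _; exact: sqr_ge0.
rewrite psumr_eq0 => [/allP/(_ k)|j _]; last exact: sqr_ge0.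
by rewrite mem_index_enum sqrf_eq0 => /(_ isT).
Qed.

Let W_ge0 : 0 <= W. Proof. exact: sqrtr_ge0. Qed.

Lemma small_miss_probability (beta c : R) : 0 < beta ->
  upper_const beta c * W < m -> (P [set om | (S om <= c * W)%R] <= beta%:E)%E.
Proof.
move=> b0; have [W0|W0] := eqVneq W 0.
  rewrite W0 mulr0 /m big1 ?ltxx// => k _.
  by rewrite W_eq0// mul0r.
have Wgt0 : 0 < W by rewrite lt_def W0 W_ge0.
move=> mW; apply: le_trans (noncentral_chi2_lower_tail xi_gauss w_ge0 Wgt0 c (ltW mW)) _.
rewrite lee_fin; apply: le_trans (expR_opp_inv_le b0); rewrite ler_expR /upper_const.
by lra.
Qed.

Let measurable_sum_xi (f : nat -> R -> R) : (forall k, measurable_fun setT (f k)) ->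
  measurable_fun setT (fun om => \sum_(k < n) f k (xi k om)).
Proof. by move=> mf; exact: (measurable_funP (partial_sum xi mf n)). Qed.

Let measurable_event (X : T -> R) (i : interval R) : measurable_fun setT X ->
  measurable [set om | X om \in i].
Proof.
move=> mX; rewrite -[[set om | _]]setTI.
exact: (mX measurableT _ (measurable_itv i)).
Qed.

(** If [m] were at most [lower_const beta * W], the acceptance event, the rejection
    event under the null hypothesis, the anticoncentration event and the event of a
    large Gaussian shift would cover the whole space, with total probability at most
    [beta + alpha + 2 eta = alpha + 1/2 < 1]. When [W = 0] the test always accepts,
    which a miss probability below [1/2] excludes. *)
Lemma signal_of_small_miss (alpha beta c : R) :
  alpha < 2^-1 -> beta < 2^-1 ->
  (P [set om | (c * W < Q om)%R] <= alpha%:E)%E ->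
  (P [set om | (S om <= c * W)%R] <= beta%:E)%E ->
  lower_const beta * W < m.
Proof.
move=> a2 b2 Pa Pb.
have [W0|W0] := eqVneq W 0.
  move: Pb; have -> : [set om | (S om <= c * W)%R] = setT.
    apply/seteqP; split => // om _ /=; rewrite W0 mulr0 /S big1// => k _.
    by rewrite W_eq0// mul0r.
  by rewrite probability_setT lee_fin; lra.
have Wgt0 : 0 < W by rewrite lt_def W0 W_ge0.
rewrite ltNge; apply/negP => mW.
have eta0 : 0 < (2^-1 - beta) / 2 by lra.
move: mW; rewrite /lower_const/=.
set eta := (2^-1 - beta) / 2 in eta0 *; set delta := (eta ^+ 2 / _) ^+ 2.
set s := 2 / (delta * eta) => mW.
have K0 := anticoncentration_const_gt0.
have delta0 : 0 < delta by rewrite /delta exprn_gt0// divr_gt0// exprn_gt0.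
have s0 : 0 < s by rewrite /s divr_gt0// mulr_gt0.
pose L om := m + 2 * \sum_(k < n) w k * mu k * xi k om.
have SE om : S om = Q om + L om.
  rewrite /S /Q /L /m addrA -big_split/= mulr_sumr -big_split/=.
  by apply: eq_bigr => k _; ring.
pose A1 := [set om | (S om <= c * W)%R].
pose A2 := [set om | (c * W < Q om)%R].
pose A3 := [set om | ((c - delta) * W < Q om <= c * W)%R].
pose A4 := [set om | (delta * W <= L om)%R].
have mS : measurable_fun setT S.
  by apply: (@measurable_sum_xi (fun k x => w k * ((mu k + x) ^+ 2 - 1))) => k;
    measurability.
have mQ : measurable_fun setT Q.
  by apply: (@measurable_sum_xi (fun k x => w k * (x ^+ 2 - 1))) => k; measurability.
have mL : measurable_fun setT L.
  apply: measurable_funD => //; apply: measurable_funM => //.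
  by apply: (@measurable_sum_xi (fun k x => w k * mu k * x)) => k; measurability.
have mA1 : measurable A1.
  rewrite (_ : A1 = [set om | S om \in `]-oo, c * W]]); first exact: measurable_event.
  by apply/seteqP; split=> om; rewrite /A1/= in_itv.
have mA2 : measurable A2.
  rewrite (_ : A2 = [set om | Q om \in `]c * W, +oo[]); first exact: measurable_event.
  by apply/seteqP; split=> om; rewrite /A2/= in_itv/= andbT.
have mA3 : measurable A3.
  rewrite (_ : A3 = [set om | Q om \in `](c - delta) * W, c * W]]).
    exact: measurable_event.
  by apply/seteqP; split=> om; rewrite /A3/= in_itv.
have mA4 : measurable A4.
  rewrite (_ : A4 = [set om | L om \in `[delta * W, +oo[]); first exact: measurable_event.
  by apply/seteqP; split=> om; rewrite /A4/= in_itv/= andbT.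
have P3 : (P A3 <= eta%:E)%E.
  have := @weighted_chi2_anticoncentration _ _ _ _ _ xi_gauss w n
    ((c - delta) * W + \sum_(k < n) w k) delta Wgt0 delta0.
  rewrite -/W.
  have <- : A3 = [set om | ((c - delta) * W + \sum_(k < n) w k
      < \sum_(k < n) w k * xi k om ^+ 2
      <= (c - delta) * W + \sum_(k < n) w k + delta * W)%R].
    have QE om : Q om = \sum_(k < n) w k * xi k om ^+ 2 - \sum_(k < n) w k.
      by rewrite -sumrB; apply: eq_bigr => k _; ring.
    apply/seteqP; split => om; rewrite /A3 /= QE => /andP[h1 h2];
      by apply/andP; split; lra.
  have -> : anticoncentration_const * Num.sqrt delta = eta ^+ 2.
    rewrite sqrtr_sqr ger0_norm; first by field; rewrite gt_eqF.
    by rewrite divr_ge0 ?sqr_ge0// ltW.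
  rewrite -(fineK (fin_num_measure P A3 mA3)) -EFinM !lee_fin -expr2.
  by rewrite ler_pXn2r// nnegrE ?fine_ge0// ltW.
have P4 : (P A4 <= eta%:E)%E.
  apply: le_trans (gaussian_shift_upper_tail xi_gauss w_ge0 Wgt0 delta s0 mW) _.
  rewrite lee_fin; apply: le_trans (expR_opp_inv_le eta0); rewrite ler_expR.
  have q0 : 0 < 2 * s ^+ 2 + s by rewrite addr_gt0// mulr_gt0// exprn_gt0.
  have -> : 2 * s ^+ 2 * (eta^-1 / (2 * s ^+ 2 + s))
      + s * (eta^-1 / (2 * s ^+ 2 + s)) = eta^-1.
    by field; rewrite !gt_eqF.
  have -> : s * delta = 2 * eta^-1 by rewrite /s; field; rewrite !gt_eqF.
  by lra.
have cover : setT `<=` A1 `|` A2 `|` A3 `|` A4.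
  move=> om _; rewrite /A1 /A2 /A3 /A4 /=.
  have [h1|h1] := leP (S om) (c * W); first by left; left; left.
  have [h2|h2] := ltP (c * W) (Q om); first by left; left; right.
  have [h3|h3] := ltP ((c - delta) * W) (Q om); first by left; right.
  by right; move: h1; rewrite SE; lra.
have : (1 <= beta%:E + alpha%:E + eta%:E + eta%:E)%E.
  rewrite -[leLHS](probability_setT P).
  apply: le_trans (le_measure _ _ _ cover) _; rewrite ?inE//.
    by do 3 apply: measurableU => //.
  do 3 (apply: le_trans (measureU2 _ _ _) _; [by do ?[apply: measurableU]|by []|
    apply: leeD => //]).
rewrite -!EFinD lee_fin /eta; lra.
Qed.

End Detection.

(** * Maxisets of weighted tests *)

Section WeightedTest.
Context {R : realType} {d : measure_display} {T : measurableType d}.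
Variables (P : probability T R) (xi : nat -> {RV P >-> R}).
Hypothesis xi_gauss : iid_std_gaussian xi.
Variables (b w : nat -> R) (D : R -> nat) (C alpha beta : R).
Hypothesis w_ge0 : forall k, 0 <= w k.

Let W eps := Num.sqrt (\sum_(k < D eps) w k ^+ 2).

(** Weights [b_k^-2] give the inverse test and the spaces [Fspace], weights [1] the
    direct test and the spaces [Gspace]. *)
Definition weighted_test : test_family R := fun eps y =>
  C * eps ^+ 2 * W eps < \sum_(k < D eps) w k * (y k ^+ 2 - eps ^+ 2).

Definition weighted_space (r : R -> R) (C' : R) : set (nat -> R) :=
  [set theta : nat -> R | l2 theta /\ forall eps, 0 < eps < 1 ->
     r eps ^+ 2 <= sqnorm theta ->
     C' * eps ^+ 2 * W eps < \sum_(k < D eps) w k * (b k * theta k) ^+ 2].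

Let law_accept (theta : nat -> R) (eps : R) : 0 < eps ->
  law xi b theta eps [set y | weighted_test eps y = false]
  = P [set om | (\sum_(k < D eps)
      w k * ((b k * theta k / eps + xi k om) ^+ 2 - 1) <= C * W eps)%R].
Proof.
move=> e0; congr (P _); apply/seteqP; split => om;
  rewrite /weighted_test /observation/=
    (_ : \sum_(k < D eps) w k * ((b k * theta k + eps * xi k om) ^+ 2 - eps ^+ 2)
     = eps ^+ 2 * \sum_(k < D eps)
      w k * ((b k * theta k / eps + xi k om) ^+ 2 - 1)).
- by move=> /negbT; rewrite -leNgt [leRHS]mulrAC [leLHS]mulrC ler_pM2r// exprn_gt0.
- by rewrite mulr_sumr; apply: eq_bigr => k _; field; rewrite gt_eqF.
- move=> h; apply/negbTE; rewrite -leNgt [leRHS]mulrAC [leLHS]mulrC ler_pM2r//.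
  by rewrite exprn_gt0.
- by rewrite mulr_sumr; apply: eq_bigr => k _; field; rewrite gt_eqF.
Qed.

Let law_reject0 (eps : R) : 0 < eps ->
  law xi b (fun=> 0) eps [set y | weighted_test eps y = true]
  = P [set om | (C * W eps < \sum_(k < D eps) w k * (xi k om ^+ 2 - 1))%R].
Proof.
move=> e0; congr (P _); apply/seteqP; split => om;
  rewrite /weighted_test /observation/=
    (_ : \sum_(k < D eps) w k * ((b k * 0 + eps * xi k om) ^+ 2 - eps ^+ 2)
     = eps ^+ 2 * \sum_(k < D eps) w k * (xi k om ^+ 2 - 1)).
- by rewrite [ltLHS]mulrAC [ltRHS]mulrC ltr_pM2r// exprn_gt0.
- by rewrite mulr_sumr; apply: eq_bigr => k _; ring.
- by move=> h; rewrite [ltLHS]mulrAC [ltRHS]mulrC ltr_pM2r// exprn_gt0.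
- by rewrite mulr_sumr; apply: eq_bigr => k _; ring.
Qed.

Let signal_scale (theta : nat -> R) (eps C' : R) : 0 < eps ->
  (C' * eps ^+ 2 * W eps < \sum_(k < D eps) w k * (b k * theta k) ^+ 2)
  = (C' * W eps < \sum_(k < D eps) w k * (b k * theta k / eps) ^+ 2).
Proof.
move=> e0; rewrite [ltLHS]mulrAC -ltr_pdivlMr ?exprn_gt0// mulr_suml.
by congr (_ < _); apply: eq_bigr => k _; rewrite expr_div_n [RHS]mulrA.
Qed.

Lemma weighted_maxiset_sandwich (r : R -> R) :
  alpha < 2^-1 -> 0 < beta < 2^-1 ->
  level xi b alpha weighted_test ->
  weighted_space r (upper_const beta C) `<=` maxiset xi b beta weighted_test r /\
  maxiset xi b beta weighted_test r `<=` weighted_space r (lower_const beta).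
Proof.
move=> a2 /andP[b0 b2] lev; split => theta [l2t H]; split => // eps e01 rt;
  have e0 : 0 < eps by case/andP: e01.
- rewrite law_accept//; apply: (small_miss_probability
    (mu := fun k => b k * theta k / eps) xi_gauss w_ge0 b0).
  by rewrite -signal_scale// H.
- rewrite signal_scale//.
  apply: (signal_of_small_miss (mu := fun k => b k * theta k / eps) xi_gauss w_ge0
    (c := C) a2 b2).
    by rewrite -law_reject0// lev.
  by rewrite -law_accept// H.
Qed.

End WeightedTest.

Unset Implicit Arguments.

Theorem theorem3p1 (R : realType) :
  (* The constants are chosen from C_{alpha,1} (resp. C_{alpha,2}) and beta
     only, hence before alpha, the noise, b, D and the detection rate. *)
  (forall beta C1 : R, 0 < beta < 2^-1 -> 0 < C1 ->
   exists Cmin Cmax : R, [/\ 0 < Cmin, 0 < Cmax &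
     forall (alpha : R) (d : measure_display) (T : measurableType d)
       (P : probability T R) (xi : nat -> {RV P >-> R})
       (b : nat -> R) (D : R -> nat) (r : R -> R),
     0 < alpha < 2^-1 ->
     iid_std_gaussian xi ->
     (forall k, 0 < b k) ->
     monotone_dimension D ->
     detection_rate r ->
     level xi b alpha (DeltaIP b D C1) ->
     Fspace b r D Cmax `<=` maxiset xi b beta (DeltaIP b D C1) r /\
     maxiset xi b beta (DeltaIP b D C1) r `<=` Fspace b r D Cmin])
  /\
  (forall beta C2 : R, 0 < beta < 2^-1 -> 0 < C2 ->
   exists C'min C'max : R, [/\ 0 < C'min, 0 < C'max &
     forall (alpha : R) (d : measure_display) (T : measurableType d)
       (P : probability T R) (xi : nat -> {RV P >-> R})
       (b : nat -> R) (D : R -> nat) (mu : R -> R),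
     0 < alpha < 2^-1 ->
     iid_std_gaussian xi ->
     (forall k, 0 < b k) ->
     monotone_dimension D ->
     detection_rate mu ->
     level xi b alpha (DeltaDP D C2) ->
     Gspace b mu D C'max `<=` maxiset xi b beta (DeltaDP D C2) mu /\
     maxiset xi b beta (DeltaDP D C2) mu `<=` Gspace b mu D C'min]).
Proof.
have upper_const_gt0 (beta C : R) : 0 < beta -> 0 < C -> 0 < upper_const beta C.
  by move=> b0 C0; rewrite /upper_const !addr_gt0 ?mulr_gt0 ?invr_gt0.
split=> beta C b01 C0; have /andP[b0 b2] := b01.
- exists (lower_const beta), (upper_const beta C); split.
  + exact: lower_const_gt0.
  + exact: upper_const_gt0.
  move=> alpha d T P xi b D r /andP[_ a2] gauss bpos _ _ lev.
  have w0 k : 0 <= b k ^- 2 by rewrite invr_ge0 sqr_ge0.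
  have WE eps : \sum_(k < D eps) (b k ^- 2) ^+ 2 = \sum_(k < D eps) b k ^- 4.
    by apply: eq_bigr => k _; rewrite exprVn -exprM.
  have testE : DeltaIP b D C = weighted_test (fun k => b k ^- 2) D C.
    by apply/funext => eps; apply/funext => y;
      rewrite /DeltaIP /weighted_test /t_threshold /T_stat WE.
  have spaceE C' : Fspace b r D C' = weighted_space b (fun k => b k ^- 2) D r C'.
    have sE (theta : nat -> R) eps : \sum_(k < D eps) theta k ^+ 2
        = \sum_(k < D eps) b k ^- 2 * (b k * theta k) ^+ 2.
      by apply: eq_bigr => k _; rewrite exprMn mulKf// expf_neq0// gt_eqF.
    by rewrite /Fspace /weighted_space; apply/seteqP; split => theta [l2t H];
      split => // eps e01 rt; have := H eps e01 rt; rewrite WE -sE.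
  move: lev; rewrite testE !spaceE => lev.
  exact: (weighted_maxiset_sandwich gauss w0 r a2 b01 lev).
- exists (lower_const beta), (upper_const beta C); split.
  + exact: lower_const_gt0.
  + exact: upper_const_gt0.
  move=> alpha d T P xi b D mu /andP[_ a2] gauss bpos _ _ lev.
  have WE eps : \sum_(k < D eps) (1 : R) ^+ 2 = (D eps)%:R.
    by under eq_bigr do rewrite expr1n; rewrite sumr_const card_ord.
  have testE : DeltaDP D C = weighted_test (fun=> 1) D C.
    apply/funext => eps; apply/funext => y.
    rewrite /DeltaDP /weighted_test /s_threshold /S_stat WE.
    by under [in RHS]eq_bigr do rewrite mul1r.
  have spaceE C' : Gspace b mu D C' = weighted_space b (fun=> 1) D mu C'.
    have sE (theta : nat -> R) eps : \sum_(k < D eps) b k ^+ 2 * theta k ^+ 2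
        = \sum_(k < D eps) 1 * (b k * theta k) ^+ 2.
      by apply: eq_bigr => k _; rewrite exprMn mul1r.
    by rewrite /Gspace /weighted_space; apply/seteqP; split => theta [l2t H];
      split => // eps e01 rt; have := H eps e01 rt; rewrite WE -sE.
  move: lev; rewrite testE !spaceE => lev.
  exact: (weighted_maxiset_sandwich gauss (fun=> ler01) mu a2 b01 lev).
Qed.
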